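(* Let $T$ be a temporal graph, $M$ a temporal motif, $\delta$ a time span, $c>0$ an integer window-size parameter, and let $C_M$ be the number of $\delta$-instances of $M$ in $T$. Let $s$ be a uniformly random shift, $Y_s$ the corresponding weighted count vector, $q_j$ the sampling probabilities, $Q_j$ the sampling indicators, $Z=\sum_j Q_j\frac{Y_{s,j}}{q_j}$, and let $\hat{Y}_s$ be the vector with coordinates $\hat{Y}_{s,j}=Y_{s,j}/\sqrt{q_j}$. Then $$\mathrm{Var}[Z]\le \mathbb{E}\big[\lVert\hat{Y}_s\rVert_2^2\big]-\mathbb{E}\big[\lVert Y_s\rVert_2^2\big]+\frac{1}{c-1}C_M^2 .$$
   Context: A temporal graph $T$ on a node set $V$ is a collection of tuples (directed temporal edges) $(u_i,v_i,t_i)$, $i=1,\dots,m$, with $u_i,v_i\in V$ and timestamps $t_i\in\mathbb{R}$; the timestamps are assumed to be unique and, without loss of generality, normalized to start at $0$. A temporal motif $M$ is a directed multigraph with an ordering on its edges, written as the ordered edge sequence $(u_1,v_1),\dots,(u_l,v_l)$. A $\delta$-instance of $M$ in $T$ is a time-ordered sequence $(w_1,x_1,t_1),\dots,(w_l,x_l,t_l)$, $t_1<\dots<t_l$, of $l$ unique temporal edges of $T$ such that there is a bijection $f$ from the nodes occurring in the sequence to the nodes of $M$ with $f(w_i)=u_i$, $f(x_i)=v_i$ for all $i$, and $t_l-t_1\le\delta$. The duration of an instance $M'$ is $\Delta(M')=t_l-t_1$. The shift $s$ is a random integer drawn uniformly from $\{-c\delta+1,\dots,0\}$, where $c>0$ is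 an integer. Set $I_j=[s+(j-1)c\delta,\; s+j\cdot c\delta-1]$ for $j=1,2,\dots$ and $\mathcal{I}_s=\{I_j : j=1,2,\dots\}$. For each $\delta$-instance $M'$ of $M$ in $T$ put $p_{M'}=1-\frac{\Delta(M')}{c\delta}$, which is stated to be the probability, over the random choice of $s$, that $M'$ is completely contained within an interval in $\mathcal{I}_s$. Let $X_{M'}(I)$ be the indicator random variable that equals $1$ if $M'$ is completely contained in the interval $I$ and $0$ otherwise. The vector $Y_s$ has coordinates $Y_{s,j}=\sum_{M'}\frac{1}{p_{M'}}X_{M'}(I_j)$, the sum being over the $\delta$-instances $M'$ of $M$ in $T$. Each interval $I_j\in\mathcal{I}_s$ is sampled independently with some probability $q_j$ (the $q_j$ are based on simple statistics of the intervals and do not necessarily sum to $1$), and $Q_j$ is the indicator random variable that equals $1$ if $I_j$ is sampled and $0$ otherwise. The expectations of $\lVert\hat{Y}_s\rVert_2^2$ and $\lVert Y_s\rVert_2^2$ are over the random shift $s$.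
   Formalization: The claim that p_{M'} is the probability that M' lies within an interval of the shifted partition is assumed (it holds for integer timestamps; for general real ones it, and the bound, can fail); also c ≥ 2, so that 1/(c-1) is defined, δ > 0 and cδ an integer. *)

(* Defs.v *)
From HB Require Import structures.
From mathcomp Require Import all_boot all_order all_algebra.
From mathcomp Require Import all_classical all_reals all_analysis.

From mathcomp Require Import zify ring lra.

Set Implicit Arguments.
Unset Strict Implicit.
Unset Printing Implicit Defensive.
Import Order.TTheory GRing.Theory Num.Theory.

Local Open Scope classical_set_scope.
Local Open Scope ring_scope.

(* The discrete sigma-algebra on [int], so that [{RV P >-> int}] makes sense. *)
HB.instance Definition _ := isPointed.Build int 0.
HB.instance Definition _ := @isMeasurable.Build default_measure_display
  int discrete_measurable (@discrete_measurable0 int)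
  (@discrete_measurableC int) (@discrete_measurableU int).

Record temporal_graph (R : realType) (V : Type) := TemporalGraph {
  nedges : nat;
  src : 'I_nedges -> V;
  dst : 'I_nedges -> V;
  time : 'I_nedges -> R;
  time_inj : injective time;
  time_ge0 : forall i, 0 <= time i;
  time_start : (0 < nedges)%N -> exists i, time i = 0 }.

(* A motif with [l.+1] ordered edges: duration and containment are only
   meaningful for a nonempty edge sequence. *)
Definition motif (W : Type) (l : nat) := 'I_l.+1 -> W * W.

Definition edge_nodes (X : Type) (n : nat) (u v : 'I_n -> X) : set X :=
  range u `|` range v.

Section Instances.
Context {R : realType} {V W : Type} {l : nat}.
Variables (T : temporal_graph R V) (M : motif W l).

(* A sequence of [l.+1] temporal edges of [T], given by their indices. *)
Definition edge_seq := {ffun 'I_l.+1 -> 'I_(nedges T)}.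

Definition duration (e : edge_seq) : R := time (e ord_max) - time (e ord0).

Definition is_instance (delta : R) (e : edge_seq) : Prop :=
  [/\ forall i j : 'I_l.+1, (i < j)%N -> time (e i) < time (e j),
      exists f : V -> W,
        set_bij (edge_nodes (fun i => src (e i)) (fun i => dst (e i)))
                (edge_nodes (fun i => (M i).1) (fun i => (M i).2)) f /\
        forall i, f (src (e i)) = (M i).1 /\ f (dst (e i)) = (M i).2
    & duration e <= delta].

Definition instances (delta : R) : pred edge_seq :=
  fun e => `[< is_instance delta e >].

Definition instance_count (delta : R) : nat := #|instances delta|.

Variables (c : nat) (delta : R).

(* The interval I_j for the shift [k]; the index [j] ranges over 1, 2, ... *)
Definition window (k : int) (j : nat) : interval R :=
  `[k%:~R + (j%:R - 1) * (c%:R * delta), k%:~R + j%:R * (c%:R * delta) - 1].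

Definition contained (k : int) (j : nat) (e : edge_seq) : bool :=
  [forall i, time (e i) \in window k j].

Definition inclusion_prob (e : edge_seq) : R :=
  1 - duration e / (c%:R * delta).

Definition Ycount (k : int) (j : nat) : R :=
  \sum_(e | instances delta e) (inclusion_prob e)^-1 * (contained k j e)%:R.

(* A sum over all j = 1, 2, ... of a finitely supported family; see
   [Ycount_finite_support]. *)
Definition sq_norm (y : nat -> R) : R :=
  \sum_(j \in [set j : nat | (0 < j)%N]) y j ^+ 2.

(* [q k j] is the probability of sampling I_j when the shift is [k]. *)
Definition Yhat (q : int -> nat -> R) (k : int) (j : nat) : R :=
  Ycount k j / Num.sqrt (q k j).

Definition in_shift_range (k : int) : bool :=
  (- (c%:R * delta) + 1 <= k%:~R) && (k%:~R <= 0 :> R).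

End Instances.

Arguments edge_seq {R V} l T.
Arguments duration {R V l T} e.

Lemma Ycount_finite_support {R : realType} {V W : Type} {l : nat}
    (T : temporal_graph R V) (M : motif W l) (c : nat) (delta : R) (k : int) :
  0 < c%:R * delta ->
  finite_set [set j : nat | Ycount T M c delta k j != 0].
Proof.
move=> w0; pose A (e : edge_seq l T) := [set j : nat | contained c delta k j e].
have sub : [set j : nat | Ycount T M c delta k j != 0] `<=` \bigcup_e A e.
  move=> j /=; apply: contra_neqP => nA.
  rewrite /Ycount big1 // => e _; case: (boolP (contained c delta k j e)).
    by move=> h; case: nA; exists e.
  by rewrite mulr0.
apply: (sub_finite_set sub); apply: bigcup_finite => [|e _]; first exact: finite_finset.
pose x := (time (e ord0) - k%:~R) / (c%:R * delta) + 1.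
apply: (sub_finite_set (B := `I_((Num.truncn x).+1))); last exact: finite_II.
move=> j /= /forallP/(_ ord0); rewrite in_itv /= => /andP[h _].
rewrite -(ltr_nat R); apply: le_lt_trans (truncnS_gt x).
by rewrite /x -lerBlDr ler_pdivlMr // lerBrDl.
Qed.

Section Sampling.
Context {d : measure_display} {Omega : measurableType d} {R : realType}.
Variable P : probability Omega R.

Definition uniform_shift (c : nat) (delta : R) (s : {RV P >-> int}) : Prop :=
  forall k : int, P (s @^-1` [set k]) =
    (if in_shift_range c delta k then (c%:R * delta)^-1 else 0)%:E.

(* The probability, over the shift, that an instance lies in some interval is
   the stated value.  For non-integer timestamps this can fail, because the
   closed intervals leave uncovered gaps of length 1; it holds whenever the
   timestamps are integers, see [inclusion_prob_correct_int]. *)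
Definition inclusion_prob_correct {V W : Type} {l : nat}
    (T : temporal_graph R V) (M : motif W l) (c : nat) (delta : R)
    (s : {RV P >-> int}) : Prop :=
  forall e : edge_seq l T, is_instance M delta e ->
    P (s @^-1` [set k | exists2 j : nat, (0 < j)%N & contained c delta k j e])
    = (inclusion_prob c delta e)%:E.

(* Each q_j is a probability.  It may vanish only where Y_{s,j} does, so that
   every quotient Y_{s,j} / q_j is meaningful (0 / 0 is read as 0). *)
Definition valid_probs {V W : Type} {l : nat}
    (T : temporal_graph R V) (M : motif W l) (c : nat) (delta : R)
    (q : int -> nat -> R) : Prop :=
  forall (k : int) (j : nat), in_shift_range c delta k -> (0 < j)%N ->
    0 <= q k j <= 1 /\ (Ycount T M c delta k j != 0 -> 0 < q k j).

(* Given the shift, the intervals are sampled mutually independently: the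
   product rule over every finite set [J] of intervals determines the
   conditional joint law of the indicators. *)
Definition independent_sampling (c : nat) (delta : R) (s : {RV P >-> int})
    (q : int -> nat -> R) (Q : nat -> {RV P >-> bool}) : Prop :=
  forall (k : int) (J : seq nat), in_shift_range c delta k -> uniq J ->
    (forall j, j \in J -> (0 < j)%N) ->
    P (s @^-1` [set k] `&` [set w | forall j, j \in J -> Q j w = true])
    = (P (s @^-1` [set k]) * (\prod_(j <- J) q k j)%:E)%E.

Definition Zest {V W : Type} {l : nat}
    (T : temporal_graph R V) (M : motif W l) (c : nat) (delta : R)
    (s : {RV P >-> int}) (q : int -> nat -> R) (Q : nat -> {RV P >-> bool})
    (w : Omega) : R :=
  \sum_(j \in [set j : nat | (0 < j)%N])
    (Q j w)%:R * (Ycount T M c delta (s w) j / q (s w) j).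

End Sampling.

Section InclusionProbability.

Let sum_modn (f : nat -> nat) (a w : nat) :
  (\sum_(0 <= r < w) f ((a + r) %% w) = \sum_(0 <= r < w) f r)%N.
Proof.
elim: a => [|a IHa].
  by apply: eq_big_nat => r rw; rewrite add0n modn_small //; case/andP: rw.
rewrite -IHa; case: w {IHa} => [|w]; first by rewrite !big_geq.
rewrite big_nat_recr //= [RHS]big_nat_recl //= addnC; congr (_ + _)%N.
  by rewrite addSnnS modnDr addn0.
by apply: eq_bigr => r _; rewrite addSnnS.
Qed.

Let count_modn (a w D : nat) : (D <= w)%N ->
  (\sum_(r < w) ((a + r) %% w + D < w : nat) = w - D)%N.
Proof.
move=> Dw; rewrite -(big_mkord xpredT (fun r => ((a + r) %% w + D < w) : nat)).
rewrite (sum_modn (fun x => (x + D < w) : nat)).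
rewrite (@big_cat_nat _ _ _ (w - D)%N) ?leq_subr //=.
rewrite [X in (X + _)%N](_ : _ = \sum_(0 <= r < w - D) 1)%N; last first.
  by apply: eq_big_nat => r h; have -> : (r + D < w)%N by lia.
rewrite sum_nat_const_nat subn0 muln1 big_nat big1 ?addn0 // => r h.
by have -> : (r + D < w)%N = false by lia.
Qed.

Context {d : measure_display} {Omega : measurableType d} {R : realType}.
Variable P : probability Omega R.

Let prob_uniform (c : nat) (delta : R) (s : {RV P >-> int}) (w : nat)
    (K : pred int) :
  (0 < w)%N -> c%:R * delta = w%:R -> uniform_shift c delta s ->
  P (s @^-1` [set k | K k]) = ((\sum_(r < w) K (- r%:Z))%:R / w%:R)%:E.
Proof.
move=> w0 cdE su; have w0' : w%:R != 0 :> R by rewrite pnatr_eq0 -lt0n.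
pose F (r : 'I_w) := s @^-1` [set - r%:Z].
have mS (A : set int) : measurable (s @^-1` A).
  by rewrite -[X in measurable X]setTI; exact: measurable_funPT.
have mF r : measurable (F r) by exact: mS.
have PF r : P (F r) = (w%:R^-1)%:E.
  rewrite su cdE ifT // /in_shift_range cdE; apply/andP; split.
    rewrite mulrNz -pmulrn; have := ltn_ord r.
    by rewrite -(ler_nat R) -natr1; lra.
  by rewrite mulrNz -pmulrn oppr_le0.
have tF (Q : {pred 'I_w}) : P (\big[setU/set0]_(r < w | Q r) F r) =
    ((\sum_(r < w) Q r)%:R / w%:R)%:E.
  rewrite measure_bigsetU_ord_cond//; last first.
    move=> i j _ _ [x []]; rewrite /F /= => -> /oppr_inj[].
    exact: val_inj.
  transitivity (\sum_(i < w | Q i) (w%:R^-1)%:E : \bar R)%E.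
    by apply: eq_bigr => i _; exact: PF.
  rewrite sumEFin; congr (_%:E).
  by rewrite big_mkcond natr_sum mulr_suml /=; apply: eq_bigr => r _;
    case: (Q r); rewrite ?mul1r ?mul0r.
have PN : P (~` \big[setU/set0]_(r < w) F r) = 0%E.
  rewrite probability_setC; last exact: bigsetU_measurable.
  rewrite tF sum1_card card_ord divff // -EFinB subrr //.
rewrite -(tF (fun r => K (- r%:Z))).
have -> : s @^-1` [set k | K k] =
  \big[setU/set0]_(r < w | K (- r%:Z)) F r `|`
  (s @^-1` [set k | K k] `\` \big[setU/set0]_(r < w) F r).
  apply/seteqP; split => x /=.
    move=> Kx; have [[r _ /= sx]|nx] :=
        pselect ((\bigcup_(r in [set: 'I_w]) F r) x).
      by left; rewrite -bigcup_seq_cond; exists r => //=;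
        rewrite mem_index_enum -sx.
    by right; split => //; rewrite -bigcup_seq => -[r _ Fr]; apply: nx;
      exists r.
  by rewrite -bigcup_seq_cond => -[[r /= /andP[_ Kr]] ->//|[]].
apply: measureU0.
- exact: bigsetU_measurable.
- by apply: measurableD; [exact: mS|exact: bigsetU_measurable].
- apply: (subset_measure0 _ _ _ PN).
  + by apply: measurableD; [exact: mS|exact: bigsetU_measurable].
  + by apply: measurableC; exact: bigsetU_measurable.
  + by move=> x [].
Qed.

Lemma inclusion_prob_correct_int {V W : Type} {l : nat}
    (T : temporal_graph R V) (M : motif W l) (c : nat) (delta : R)
    (s : {RV P >-> int}) :
  0 < delta -> (0 < c)%N -> c%:R * delta \is a Num.nat ->
  (forall i : 'I_(nedges T), time i \is a Num.int) ->
  uniform_shift c delta s -> inclusion_prob_correct T M c delta s.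
Proof.
move=> delta0 c0 /natrP[w cdE] tint su e [inc _ dle].
have w0 : (0 < w)%N by rewrite -(ltr_nat R) -cdE mulr_gt0 // ltr0n.
have tnat (i : 'I_(nedges T)) : {n : nat | time i = n%:R}.
  apply: cid; apply/natrP; rewrite natrEint tint /=; exact: time_ge0.
pose a i := projT1 (tnat (e i)).
have aE i : time (e i) = (a i)%:R by rewrite /a; case: (tnat (e i)).
have amon (i j : 'I_l.+1) : (i <= j)%N -> (a i <= a j)%N.
  rewrite leq_eqVlt => /orP[/eqP/val_inj -> //|/inc].
  by rewrite !aE ltr_nat => /ltnW.
pose a0 := a ord0; pose D := (a ord_max - a0)%N.
have a0D : a ord_max = (a0 + D)%N by rewrite /D subnKC // amon.
have dE : duration e = D%:R by rewrite /duration !aE a0D natrD addrC addKr.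
have Dw : (D <= w)%N.
  by rewrite -(ler_nat R) -dE -cdE (le_trans dle) // ler_peMl ?ler1n // ltW.
rewrite [X in s @^-1` X](_ : _ = [set k | `[< exists2 j : nat,
    (0 < j)%N & contained c delta k j e >]]); last first.
  by apply/seteqP; split => k /= /asboolP.
rewrite (prob_uniform _ w0 cdE su) /inclusion_prob dE cdE.
rewrite (eq_bigr (fun r : 'I_w => ((a0 + r) %% w + D < w)%N : nat)); last first.
  move=> r _; congr (nat_of_bool _); apply/asboolP/idP => [[j j0 /forallP ct]|h].
    have := ct ord0; have := ct ord_max.
    rewrite !aE a0D -/a0 !in_itv /= cdE mulrNz -pmulrn.
    case: j j0 {ct} => // j _; rewrite -natr1 addrK.
    move=> /andP[_ h1] /andP[h2 _].
    have {}h1 : (a0 + D + r + 1 <= j.+1 * w)%N.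
      by rewrite -(ler_nat R) !natrD natrM -natr1; move: h1; rewrite natrD; lra.
    have {}h2 : (j * w <= a0 + r)%N.
      by rewrite -(ler_nat R) natrM !natrD; lra.
    have := divn_eq (a0 + r) w; have := ltn_pmod (a0 + r) w0.
    have : (j <= (a0 + r) %/ w)%N by rewrite leq_divRL.
    nia.
  exists ((a0 + r) %/ w).+1 => //; apply/forallP => i.
  rewrite aE in_itv /= cdE mulrNz -pmulrn -natr1 addrK.
  have h0 := amon ord0 i (leq0n _).
  have h1 := amon i ord_max (leq_ord i).
  have h2 := divn_eq (a0 + r) w.
  set m := ((a0 + r) %/ w)%N in h2 *.
  have g1 : (m * w <= a i + r)%N by rewrite -/a0 in h0; lia.
  have g2 : (a i + r + 1 <= m * w + w)%N by lia.
  move: g1 g2; rewrite -!(ler_nat R) !natrD natrM => g1 g2.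
  by apply/andP; split; lra.
rewrite count_modn // natrB // mulrBl divff // pnatr_eq0 -lt0n //.
Qed.

End InclusionProbability.

(* Main.v *)
(* Condition on the shift s.  Given s, the sampled terms are independent, so Z has
   mean S = sum_j Y_{s,j} and second moment
   sum_j Y_{s,j}^2 / q_j + S^2 - sum_j Y_{s,j}^2.  Averaging over s,
   Var[Z] = E||Yhat||^2 - E||Y||^2 + E[S^2] - E[S]^2.  Windows of one shift are
   disjoint, so S is the sum over instances e of 1/p_e times the indicator that e
   lies in some window; hence E[S] = C_M.  In E[S^2] a pair (e, e') contributes at
   most p_e / (p_e p_e') = 1 / p_e' <= c / (c - 1), so E[S^2] - E[S]^2 is at most
   C_M^2 / (c - 1). *)
Require Import Defs.
From HB Require Import structures.
From mathcomp Require Import all_boot all_order all_algebra.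
From mathcomp Require Import all_classical all_reals all_analysis.
From mathcomp Require Import measurable_realfun.
From mathcomp Require Import ring lra.

Set Implicit Arguments.
Unset Strict Implicit.
Unset Printing Implicit Defensive.
Import Order.TTheory GRing.Theory Num.Theory.

Local Open Scope classical_set_scope.
Local Open Scope ring_scope.

(** * Finite sums over windows and indicators *)

Lemma fsumr_nat_bound (R : nmodType) (f : nat -> R) (n : nat) :
  (forall j, (n <= j)%N -> f j = 0) ->
  \sum_(j \in [set j : nat | (0 < j)%N]) f j = \sum_(j <- index_iota 1 n) f j.
Proof.
move=> f0; rewrite [RHS]fsbig_seq ?iota_uniq //; symmetry.
rewrite (fsbig_widen [set` index_iota 1 n] [set j : nat | (0 < j)%N]) //.
  by move=> j /=; rewrite mem_index_iota => /andP[].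
move=> j [/= j0]; rewrite mem_index_iota j0 /= => /negP.
by rewrite -leqNgt => /f0.
Qed.

Lemma sum_nat_of_bool_unique (R : pzSemiRingType) (b : nat -> bool) (J : seq nat) :
  uniq J -> {in J &, forall i j, b i -> b j -> i = j} ->
  \sum_(j <- J) (b j)%:R = (has b J)%:R :> R.
Proof.
move=> uJ bu; have [/hasP[i iJ bi]|/hasPn nb] := boolP (has b J).
  rewrite (bigD1_seq i) //= bi big1_seq ?addr0 // => j /andP[ji jJ].
  by case: (boolP (b j)) => // bj; rewrite (bu _ _ jJ iJ bj bi) eqxx in ji.
by rewrite big1_seq // => j /andP[_ /nb /negbTE ->].
Qed.

Lemma sqr_sum (R : comPzSemiRingType) (I : Type) (r : seq I) (P : pred I)
    (f : I -> R) :
  (\sum_(i <- r | P i) f i) ^+ 2 = \sum_(i <- r | P i) \sum_(j <- r | P j) f i * f j.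
Proof. by rewrite expr2 mulr_suml; apply: eq_bigr => i _; rewrite mulr_sumr. Qed.

(** * Moments of a count weighted by inverse frequencies *)

Section WeightedCount.
Context {R : realFieldType} {I : finType} (D : pred I) (n : nat).
Variables (A : 'I_n -> I -> bool) (p : I -> R).
Hypothesis p_freq : forall e, D e -> \sum_(r < n) (A r e)%:R / n%:R = p e.

(** In the application [r] runs over the equally likely shifts, and [A r e] says that some window of
    that shift contains the instance [e]. *)
Let count r : R := \sum_(e | D e) (p e)^-1 * (A r e)%:R.

Lemma mean_weighted_count : (forall e, D e -> p e != 0) ->
  \sum_(r < n) count r / n%:R = #|D|%:R.
Proof.
move=> p0; under eq_bigr do rewrite /count mulr_suml.
rewrite exchange_big /= -sum1_card natr_sum; apply: eq_big => // e De.
under eq_bigr do rewrite -mulrA.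
by rewrite -mulr_sumr p_freq // mulVf // p0.
Qed.

(* Two instances lie in a common window with probability at most [p e], so each
   pair contributes at most [1 / p e'] to the second moment. *)
Lemma mean_sqr_weighted_count (g : R) : 0 < g -> (forall e, D e -> g <= p e) ->
  \sum_(r < n) count r ^+ 2 / n%:R <= g^-1 * #|D|%:R ^+ 2.
Proof.
move=> g0 gp; have p0 e : D e -> 0 < p e by move=> /gp; exact: lt_le_trans.
under eq_bigr do rewrite /count sqr_sum mulr_suml.
rewrite exchange_big /=.
have -> : g^-1 * #|D|%:R ^+ 2 = \sum_(e | D e) \sum_(e' | D e') g^-1.
  have s1 (x : R) : \sum_(e | D e) x = x * #|D|%:R by rewrite sumr_const mulr_natr.
  by rewrite !s1 expr2 mulrA.
apply: ler_sum => e De.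
under eq_bigr do rewrite mulr_suml.
rewrite exchange_big /=; apply: ler_sum => e' De'.
(* Bounding the indicator of [e'] by 1 leaves the frequency of [e], which cancels [(p e)^-1]. *)
apply: (@le_trans _ _ (\sum_(r < n) (p e)^-1 * (p e')^-1 * ((A r e)%:R / n%:R))).
  apply: ler_sum => r _; rewrite mulrACA -[leLHS]mulrA; apply: ler_wpM2l.
    by rewrite mulr_ge0 // invr_ge0 ltW // p0.
  rewrite -mulrA; apply: ler_wpM2l => //.
  by case: (A r e'); rewrite ?mul1r ?mul0r ?invr_ge0.
rewrite -mulr_sumr p_freq // mulrAC mulVf ?gt_eqF ?p0 // mul1r.
by rewrite lef_pV2 ?posrE ?gp ?p0.
Qed.

End WeightedCount.

(** * Expectation and measurability tools *)

Section Expectation.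
Context {d : measure_display} {Omega : measurableType d} {R : realType}.
Variable P : probability Omega R.

Lemma expectation_indic_sum (I : Type) (L : seq I) (a : I -> R)
    (B : I -> set Omega) : (forall x, measurable (B x)) ->
  (fun w => \sum_(x <- L) a x * \1_(B x) w) \in Lfun P 1 /\
  'E_P[fun w => (\sum_(x <- L) a x * \1_(B x) w)%R]%E =
    (\sum_(x <- L) a x * fine (P (B x)))%:E.
Proof.
move=> mB; elim: L => [|x L [intL EL]].
  under eq_fun do rewrite big_nil.
  by rewrite big_nil; split; [exact: Lfun_cst|exact: expectation_cst].
have i1 : \1_(B x) \in Lfun P 1.
  by apply/Lfun1_integrable; exact: integrable_indic.
have -> : (fun w => \sum_(y <- x :: L) a y * \1_(B y) w) =
    (a x \o* \1_(B x)) \+ (fun w => \sum_(y <- L) a y * \1_(B y) w).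
  by apply/funext => w; rewrite big_cons /= mulrC.
split; first by rewrite rpredD //=; exact: Lfun_scale.
rewrite expectationD ?Lfun_scale // expectationZl // EL big_cons EFinD EFinM.
by rewrite expectation_indic // fineK // fin_num_measure.
Qed.

(** Serves to discard the null event of shifts outside the range. Measurability of [X] is assumed
    because [P] may be incomplete, so agreement off a null set does not give it. *)
Lemma ae_eq_expectation (X G : Omega -> R) (N : set Omega) :
  measurable_fun setT X -> measurable N -> P N = 0%E ->
  (forall w, ~ N w -> X w = G w) -> G \in Lfun P 1 ->
  X \in Lfun P 1 /\ 'E_P[X]%E = 'E_P[G]%E.
Proof.
move=> mX mN PN XG /Lfun1_integrable iG; split; last first.
  rewrite unlock; apply: ae_eq_integral => //.
  - exact/measurable_EFinP.
  - exact: measurable_int iG.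
  - by exists N; split => // w /= h; apply: contrapT => /XG XGw; apply: h;
      rewrite XGw.
apply/Lfun1_integrable/(@negligible_integrable _ _ _ _ _ N) => //.
  exact/measurable_EFinP.
have mD : measurable (setT `\` N) by exact: measurableD.
apply: (@eq_integrable _ _ _ P _ mD (EFin \o G)).
  by move=> w /set_mem [_ /XG /= ->].
exact: (integrableS measurableT).
Qed.

Lemma measurable_rv_preimage (s : {RV P >-> int}) (A : set int) :
  measurable (s @^-1` A).
Proof. by rewrite -[X in measurable X]setTI; exact: measurable_funPT. Qed.

Lemma measurable_rv_bool (Q : {RV P >-> bool}) : measurable [set w | Q w].
Proof.
rewrite -[X in measurable X]/(Q @^-1` [set true]) -[X in measurable X]setTI.
exact: measurable_funPT.
Qed.

(** [int] is countable, so a preimage splits into countably many pieces according to the value of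
    [s]. *)
Lemma measurable_fun_piecewise (s : {RV P >-> int}) (F : int -> Omega -> R) :
  (forall k, measurable_fun setT (F k)) ->
  measurable_fun setT (fun w => F (s w) w).
Proof.
move=> mF _ A mA; rewrite setTI.
have -> : (fun w => F (s w) w) @^-1` A =
    \bigcup_(k in [set: int]) (s @^-1` [set k] `&` F k @^-1` A).
  by apply/seteqP; split => [w Aw|w [k _ [/= <-]]] //; exists (s w).
apply: countable_bigcupT_measurable => // k; apply: measurableI.
  exact: measurable_rv_preimage.
by rewrite -[X in measurable X]setTI; exact: mF.
Qed.

End Expectation.

(** * Averaging over the uniform shift *)

Section UniformShift.
Context {d : measure_display} {Omega : measurableType d} {R : realType}.
Context {P : probability Omega R}.
Variables (c n : nat) (delta : R) (s : {RV P >-> int}).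
Hypotheses (n_gt0 : (0 < n)%N) (nE : c%:R * delta = n%:R).
Hypothesis s_unif : uniform_shift c delta s.

(** Parametrises the admissible shifts by ['I_n], so that averages over [s] become sums over
    [r < n]. *)
Lemma ord_in_shift_range (r : 'I_n) : in_shift_range c delta (- r%:Z).
Proof.
rewrite /in_shift_range nE mulrNz -pmulrn oppr_le0 ler0n andbT.
by have := ltn_ord r; rewrite -(ler_nat R) -natr1; lra.
Qed.

Lemma prob_shift (r : 'I_n) : P (s @^-1` [set - r%:Z]) = (n%:R^-1)%:E.
Proof. by rewrite s_unif ord_in_shift_range nE. Qed.

(** The [n] values [- r] have mass [1 / n] each, which already exhausts the total mass 1. *)
Lemma ae_shift_range : P [set w | ~ exists r : 'I_n, s w = - r%:Z] = 0%E.
Proof.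
pose S (r : 'I_n) := s @^-1` [set - r%:Z].
have mS r : measurable (S r) by exact: measurable_rv_preimage.
have -> : [set w | ~ exists r : 'I_n, s w = - r%:Z] =
    ~` \big[setU/set0]_(r < n) S r.
  apply/seteqP; split => w; rewrite -bigcup_seq /=; apply: contra_not.
    by move=> [r _ Sr]; exists r.
  by move=> [r sr]; exists r => //=; rewrite mem_index_enum.
rewrite probability_setC; last exact: bigsetU_measurable.
rewrite measure_bigsetU_ord //=; last first.
  by move=> i j _ _ [x []]; rewrite /S /= => -> /oppr_inj[]; exact: val_inj.
rewrite (eq_bigr (fun=> (n%:R^-1)%:E)) => [|r _]; last exact: prob_shift.
rewrite sumEFin sumr_const card_ord -[_^-1 *+ _]mulr_natr mulVf ?subee //.
by rewrite pnatr_eq0 -lt0n.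
Qed.

(** Off a null event, [F (s w) w] is a finite combination of the indicators of [s = - r] intersected
    with [B x]. Coefficients and index lists may depend on the shift; the events [B x] do not. *)
Lemma expectation_shift_sum (I : Type) (F : int -> Omega -> R)
    (L : 'I_n -> seq I) (a : 'I_n -> I -> R) (B : I -> set Omega) :
  (forall k, measurable_fun setT (F k)) -> (forall x, measurable (B x)) ->
  (forall (r : 'I_n) w, F (- r%:Z) w = \sum_(x <- L r) a r x * \1_(B x) w) ->
  (fun w => F (s w) w) \in Lfun P 1 /\
  'E_P[fun w => F (s w) w]%E =
    (\sum_(r < n) \sum_(x <- L r)
       a r x * fine (P (s @^-1` [set - r%:Z] `&` B x)))%:E.
Proof.
move=> mF mB FE.
pose B' (rx : 'I_n * I) := s @^-1` [set - rx.1%:Z] `&` B rx.2.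
have mB' rx : measurable (B' rx).
  by apply: measurableI => //; exact: measurable_rv_preimage.
pose L' := [seq (r, x) | r <- index_enum 'I_n, x <- L r].
have [iG EG] := expectation_indic_sum P L' (fun rx => a rx.1 rx.2) mB'.
have mN : measurable [set w | ~ exists r : 'I_n, s w = - r%:Z].
  rewrite -[X in measurable X]/(s @^-1` [set k | ~ exists r : 'I_n, k = - r%:Z]).
  exact: measurable_rv_preimage.
have [|iX ->] := ae_eq_expectation (measurable_fun_piecewise s mF) mN
    ae_shift_range _ iG; last first.
  by split=> //; rewrite EG big_allpairs_dep.
(* Exactly one block of the combined sum survives at [w], the one of the actual shift. *)
move=> w /contrapT [r sr]; rewrite sr FE big_allpairs_dep /= (bigD1 r) //=.
rewrite [X in _ + X]big1 ?addr0 => [|i ir].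
  by apply: eq_bigr => x _; rewrite /B' indicI /= [\1_(s @^-1` _) w]indicE
    mem_set // mul1r.
apply: big1 => x _; rewrite /B' indicI /= [\1_(s @^-1` _) w]indicE
  memNset ?mul0r ?mulr0 //=.
by rewrite sr => /oppr_inj [] /val_inj ri; rewrite ri eqxx in ir.
Qed.

Lemma expectation_shift (f : int -> R) :
  (fun w => f (s w)) \in Lfun P 1 /\
  'E_P[fun w => f (s w)]%E = (\sum_(r < n) f (- r%:Z) / n%:R)%:E.
Proof.
have [|||i ->] := @expectation_shift_sum unit (fun k _ => f k)
    (fun=> [:: tt]) (fun r _ => f (- r%:Z)) (fun=> setT).
- by move=> k; exact: measurable_cst.
- by [].
- by move=> r w; rewrite big_seq1 indicT mulr1.
split=> //; congr _%:E; apply: eq_bigr => r _.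
by rewrite big_seq1 setIT prob_shift.
Qed.

Lemma prob_shift_in (K : pred int) :
  P (s @^-1` [set k | K k]) = (\sum_(r < n) (K (- r%:Z))%:R / n%:R)%:E.
Proof.
rewrite -(expectation_shift (fun k => (K k)%:R)).2.
rewrite -expectation_indic; last exact: measurable_rv_preimage.
congr expectation; apply/funext => w; rewrite indicE; congr (nat_of_bool _)%:R.
by apply/idP/idP => [|Kw]; [move/set_mem|exact/mem_set].
Qed.

End UniformShift.

(** * Disjointness of windows and the total count of one shift *)

Section Windows.
Context {R : realType} {V W : Type} {l : nat}.
Variables (T : temporal_graph R V) (M : motif W l) (c : nat) (delta : R).
Hypothesis cdelta_gt0 : 0 < c%:R * delta.

(** The first edge alone decides: for [i < j] the right end of window [i] is at least 1 below the
    left end of window [j]. *)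
Lemma contained_inj (k : int) (i j : nat) (e : edge_seq l T) :
  contained c delta k i e -> contained c delta k j e -> i = j.
Proof.
move=> /forallP/(_ ord0) + /forallP/(_ ord0).
rewrite !in_itv /=; wlog ij : i j / (i < j)%N.
  move=> h Ci Cj; have [/h|/h hji|//] := ltngtP i j; first exact.
  by apply/esym/hji.
move=> /andP[_ h1] /andP[h2 _].
have : 0 <= (j%:R - 1 - i%:R) * (c%:R * delta).
  apply: mulr_ge0; last exact: ltW.
  by move: ij; rewrite -(ler_nat R) -natr1; lra.
by move=> h3; exfalso; lra.
Qed.

Lemma contained_bound (k : int) : exists n : nat,
  forall j (e : edge_seq l T), (n <= j)%N -> contained c delta k j e = false.
Proof.
(* Solving the left-end inequality of window [j] for [j] gives [j <= x e]; a maximum over the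
   finitely many edge sequences makes the bound uniform. *)
pose x (e : edge_seq l T) := (time (e ord0) - k%:~R) / (c%:R * delta) + 1.
exists (\max_e Num.truncn (x e))%N.+1 => j e nj; apply/negP => /forallP/(_ ord0).
rewrite in_itv /= => /andP[h _].
have : (Num.truncn (x e)).+1%:R <= j%:R :> R.
  by rewrite ler_nat (leq_trans _ nj) // ltnS (leq_bigmax e).
apply/negP; rewrite -ltNge; apply: le_lt_trans (truncnS_gt _).
by rewrite /x -lerBlDr ler_pdivlMr // lerBrDl.
Qed.

Lemma Ycount_eq0 (k : int) (j : nat) :
  (forall e : edge_seq l T, contained c delta k j e = false) ->
  Ycount T M c delta k j = 0.
Proof. by move=> h; rewrite /Ycount big1 // => e _; rewrite h mulr0. Qed.

(** After exchanging sums, disjointness turns the number of windows containing [e] into the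
    indicator that one does. *)
Lemma sum_Ycount (k : int) (n : nat) :
  (forall j (e : edge_seq l T), (n <= j)%N -> contained c delta k j e = false) ->
  \sum_(j <- index_iota 1 n) Ycount T M c delta k j =
  \sum_(e : edge_seq l T | instances M delta e) (inclusion_prob c delta e)^-1 *
    `[< exists2 j : nat, (0 < j)%N & contained c delta k j e >]%:R.
Proof.
move=> hn; rewrite /Ycount exchange_big /=; apply: eq_bigr => e _.
rewrite -mulr_sumr; congr (_ * _).
rewrite sum_nat_of_bool_unique ?iota_uniq //; last first.
  by move=> i j _ _; exact: contained_inj.
congr (nat_of_bool _)%:R; apply/hasP/asboolP => [[j]|[j j0 cj]].
  by rewrite mem_index_iota => /andP[j0 _] cj; exists j.
exists j => //; rewrite mem_index_iota j0 ltnNge /=.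
by apply/negP => /hn - /(_ e); rewrite cj.
Qed.

End Windows.

(** The [if] is the joint sampling probability of windows [i] and [j]. Off-diagonal terms reduce to
    [y i * y j], the diagonal ones to [y i ^+ 2 / q i]; completing the square adds and removes the
    diagonal [y i ^+ 2]. *)
Lemma bernoulli_second_moment (R : fieldType) (J : seq nat) (y q : nat -> R) :
  uniq J -> {in J, forall j, y j != 0 -> q j != 0} ->
  \sum_(i <- J) \sum_(j <- J)
      (y i / q i) * (y j / q j) * (if i == j then q i else q i * q j) =
  \sum_(j <- J) y j ^+ 2 / q j + (\sum_(j <- J) y j) ^+ 2 - \sum_(j <- J) y j ^+ 2.
Proof.
move=> uJ yq; have yK j : j \in J -> y j / q j * q j = y j.
  move=> /yq; have [->|_ /(_ isT)] := eqVneq (y j) 0; first by rewrite !mul0r.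
  by move=> q0; rewrite divfK.
rewrite sqr_sum addrAC -sumrB -big_split /=.
rewrite big_seq [RHS]big_seq; apply: eq_bigr => i iJ.
rewrite (bigD1_seq i) //= eqxx [in RHS](bigD1_seq i) //= addrA; congr (_ + _).
  by rewrite -mulrA yK // -expr2 mulrAC -expr2 subrK.
rewrite big_seq_cond [RHS]big_seq_cond; apply: eq_bigr => j /andP[jJ ji].
by rewrite eq_sym (negbTE ji) mulrACA !yK.
Qed.

(** * Moments of the estimator *)

Section Estimator.
Context {R : realType} {V W : Type} {l : nat}.
Variables (T : temporal_graph R V) (M : motif W l) (delta : R) (c : nat).
Context {d : measure_display} {Omega : measurableType d}.
Variables (P : probability Omega R) (s : {RV P >-> int}).
Variables (q : int -> nat -> R) (Q : nat -> {RV P >-> bool}).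
Hypotheses (delta_gt0 : 0 < delta) (c_gt1 : (1 < c)%N).
Hypothesis s_unif : uniform_shift c delta s.
Variables (n : nat).
Hypotheses (n_gt0 : (0 < n)%N) (nE : c%:R * delta = n%:R).

Let Y := Ycount T M c delta.

Let c_gt0 : 0 < c%:R :> R. Proof. by rewrite ltr0n ltnW. Qed.
Let cdelta_gt0 : 0 < c%:R * delta. Proof. exact: mulr_gt0. Qed.

(** Durations are at most [delta]. This bound, positive since [c > 1], is the source of the factor
    [c / (c - 1)]. *)
Lemma inclusion_prob_ge (e : edge_seq l T) :
  instances M delta e -> 1 - c%:R^-1 <= inclusion_prob c delta e.
Proof.
move=> /asboolP[_ _ de]; rewrite lerD2l lerN2 ler_pdivrMr //.
by rewrite mulrA mulVf ?mul1r // gt_eqF.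
Qed.

Let g_gt0 : 0 < 1 - c%:R^-1 :> R.
Proof. by rewrite subr_gt0 invf_lt1 // ltr1n. Qed.

Variable N : int -> nat.
Hypothesis contained_N : forall k j (e : edge_seq l T),
  (N k <= j)%N -> contained c delta k j e = false.

(** No window of shift [k] from index [N k] on contains an edge sequence, so sums over all windows
    reduce to [J k]. *)
Let J k := index_iota 1 (N k).

Let Y0 k j : (N k <= j)%N -> Y k j = 0.
Proof. by move=> h; apply: Ycount_eq0 => e; exact: contained_N. Qed.

Section Moments.
Hypothesis p_correct : inclusion_prob_correct T M c delta s.

Let A (r : 'I_n) (e : edge_seq l T) : bool :=
  `[< exists2 j : nat, (0 < j)%N & contained c delta (- r%:Z) j e >].

(** Reads the assumed inclusion probability as a frequency among the [n] shifts. *)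
Let A_freq e : instances M delta e ->
  \sum_(r < n) (A r e)%:R / n%:R = inclusion_prob c delta e.
Proof.
move=> /asboolP ie; apply: EFin_inj; rewrite -(p_correct ie).
rewrite -(prob_shift_in n_gt0 nE s_unif (fun k =>
  `[< exists2 j : nat, (0 < j)%N & contained c delta k j e >])).
by congr (P _); apply/seteqP; split => w /= /asboolP.
Qed.

Lemma mean_total_count :
  \sum_(r < n) (\sum_(j <- J (- r%:Z)) Y (- r%:Z) j) / n%:R =
    (instance_count T M delta)%:R.
Proof.
rewrite /instance_count -(mean_weighted_count A_freq).
  by apply: eq_bigr => r _; rewrite (sum_Ycount M cdelta_gt0 (@contained_N _)).
by move=> e /inclusion_prob_ge ge; rewrite gt_eqF // (lt_le_trans g_gt0).
Qed.

Lemma mean_sqr_total_count :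
  \sum_(r < n) (\sum_(j <- J (- r%:Z)) Y (- r%:Z) j) ^+ 2 / n%:R <=
    (1 - c%:R^-1)^-1 * (instance_count T M delta)%:R ^+ 2.
Proof.
apply: le_trans (mean_sqr_weighted_count A_freq g_gt0 inclusion_prob_ge).
by apply: ler_sum => r _; rewrite (sum_Ycount M cdelta_gt0 (@contained_N _)).
Qed.

End Moments.

Lemma expectation_sq_norm_Ycount :
  'E_P[fun w => sq_norm (Y (s w))]%E =
    (\sum_(r < n) (\sum_(j <- J (- r%:Z)) Y (- r%:Z) j ^+ 2) / n%:R)%:E.
Proof.
rewrite (expectation_shift n_gt0 nE s_unif (fun k => sq_norm (Y k))).2.
congr _%:E; apply: eq_bigr => r _; congr (_ / _); apply: fsumr_nat_bound => j Nj.
by rewrite Y0 // expr0n.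
Qed.

Hypothesis q_valid : valid_probs T M c delta q.

Lemma expectation_sq_norm_Yhat :
  'E_P[fun w => sq_norm (Yhat T M c delta q (s w))]%E =
    (\sum_(r < n)
      (\sum_(j <- J (- r%:Z)) Y (- r%:Z) j ^+ 2 / q (- r%:Z) j) / n%:R)%:E.
Proof.
rewrite (expectation_shift n_gt0 nE s_unif
  (fun k => sq_norm (Yhat T M c delta q k))).2.
congr _%:E; apply: eq_bigr => r _; congr (_ / _).
rewrite /sq_norm (@fsumr_nat_bound _ _ (N (- r%:Z))) => [|j Nj]; last first.
  by rewrite /Yhat -/Y Y0 // mul0r expr0n.
rewrite big_seq [RHS]big_seq; apply: eq_bigr => j; rewrite mem_index_iota.
(* Squaring undoes the square root only for nonnegative [q], which is known for admissible shifts
   and [0 < j]. *)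
move=> /andP[j0 _]; have [/andP[q0 _] _] := q_valid (ord_in_shift_range nE r) j0.
by rewrite /Yhat expr_div_n sqr_sqrtr.
Qed.

Hypothesis Q_indep : independent_sampling c delta s q Q.

(** The estimator with its shift frozen at [k], in the form that [expectation_shift_sum] expects. *)
Let Zk k w : R := \sum_(j <- J k) (Y k j / q k j) * \1_[set v | Q j v] w.

Let ZestE w : Zest T M c delta s q Q w = Zk (s w) w.
Proof.
rewrite /Zest (@fsumr_nat_bound _ _ (N (s w))) => [|j Nj]; last first.
  by rewrite -/Y Y0 // mul0r mulr0.
apply: eq_bigr => j _; rewrite mulrC indicE; congr (_ * (nat_of_bool _)%:R).
by apply/idP/idP => [h|/set_mem]; [exact/mem_set|].
Qed.

Let measurable_Zk k : measurable_fun setT (Zk k).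
Proof.
apply: measurable_sum => j; apply: measurable_funM => //.
by apply: measurable_indic; exact: measurable_rv_bool.
Qed.

Let prob_sampled (r : 'I_n) (j : nat) : j \in J (- r%:Z) ->
  fine (P (s @^-1` [set - r%:Z] `&` [set v | Q j v])) = q (- r%:Z) j / n%:R.
Proof.
rewrite mem_index_iota => /andP[j0 _].
have := @Q_indep _ [:: j] (ord_in_shift_range nE r) isT.
rewrite (prob_shift nE s_unif) big_seq1 -EFinM mulrC => h.
rewrite -[RHS]/(fine (_%:E)) -h; last first.
  by move=> i; rewrite inE => /eqP ->.
congr (fine (P (_ `&` _))); apply/seteqP; split => w /= {}h.
  by move=> i; rewrite inE => /eqP ->.
by apply: h; rewrite inE.
Qed.

(** On the diagonal the two events coincide; off it, the product rule applies to the duplicate-free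
    list [[:: i; j]]. *)
Let prob_sampled2 (r : 'I_n) (i j : nat) : i \in J (- r%:Z) -> j \in J (- r%:Z) ->
  fine (P (s @^-1` [set - r%:Z] `&` ([set v | Q i v] `&` [set v | Q j v]))) =
  (if i == j then q (- r%:Z) i else q (- r%:Z) i * q (- r%:Z) j) / n%:R.
Proof.
move=> iJ jJ; case: eqVneq => [<-|ij]; first by rewrite setIid prob_sampled.
move: iJ jJ; rewrite !mem_index_iota => /andP[i0 _] /andP[j0 _].
have := @Q_indep _ [:: i; j] (ord_in_shift_range nE r).
rewrite /= inE ij => /(_ isT).
rewrite (prob_shift nE s_unif) big_cons big_seq1 -EFinM mulrC => h.
rewrite -[RHS]/(fine (_%:E)) -h; last first.
  by move=> m; rewrite !inE => /orP[] /eqP ->.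
congr (fine (P (_ `&` _))); apply/seteqP; split => w /= {}h.
  by move: h => [Qi Qj] m; rewrite !inE => /orP[] /eqP ->.
by split; apply: h; rewrite !inE eqxx ?orbT.
Qed.

Let q_neq0 (r : 'I_n) (j : nat) : j \in J (- r%:Z) ->
  Y (- r%:Z) j != 0 -> q (- r%:Z) j != 0.
Proof.
rewrite mem_index_iota => /andP[j0 _] /((q_valid (ord_in_shift_range nE r) j0).2).
by move=> /gt_eqF ->.
Qed.

Lemma expectation_Zest :
  Zest T M c delta s q Q \in Lfun P 1 /\
  'E_P[Zest T M c delta s q Q]%E =
    (\sum_(r < n) (\sum_(j <- J (- r%:Z)) Y (- r%:Z) j) / n%:R)%:E.
Proof.
have -> : Zest T M c delta s q Q = (fun w => Zk (s w) w) by exact/funext.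
have [|||i ->] := @expectation_shift_sum _ _ _ _ _ _ _ _ n_gt0 nE s_unif nat Zk
    (fun r => J (- r%:Z)) (fun r j => Y (- r%:Z) j / q (- r%:Z) j)
    (fun j => [set v | Q j v]) => //.
  by move=> j; exact: measurable_rv_bool.
split=> //; congr _%:E; apply: eq_bigr => r _; rewrite mulr_suml.
rewrite big_seq [RHS]big_seq; apply: eq_bigr => j jJ.
rewrite prob_sampled // mulrA; congr (_ / _).
(* [q] may vanish where [Y] does; the quotient is then 0, which is still the right value. *)
have [->|/(q_neq0 jJ)] := eqVneq (Y (- r%:Z) j) 0; first by rewrite !mul0r.
by move=> q0; rewrite divfK.
Qed.

(** Expanding the square gives a combination indexed by pairs of windows, whose events are
    intersections of two sampling events. *)
Lemma expectation_sqr_Zest :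
  (Zest T M c delta s q Q * Zest T M c delta s q Q)%R \in Lfun P 1 /\
  'E_P[Zest T M c delta s q Q * Zest T M c delta s q Q]%E =
    (\sum_(r < n) (\sum_(j <- J (- r%:Z)) Y (- r%:Z) j ^+ 2 / q (- r%:Z) j
      + (\sum_(j <- J (- r%:Z)) Y (- r%:Z) j) ^+ 2
      - \sum_(j <- J (- r%:Z)) Y (- r%:Z) j ^+ 2) / n%:R)%:E.
Proof.
have -> : (Zest T M c delta s q Q * Zest T M c delta s q Q)%R =
    (fun w => Zk (s w) w * Zk (s w) w).
  by apply/funext => w; rewrite /= -ZestE.
have [|||i ->] := @expectation_shift_sum _ _ _ _ _ _ _ _ n_gt0 nE s_unif
    (nat * nat)%type (fun k w => Zk k w * Zk k w)
    (fun r => [seq (i, j) | i <- J (- r%:Z), j <- J (- r%:Z)])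
    (fun r ij => (Y (- r%:Z) ij.1 / q (- r%:Z) ij.1) *
                 (Y (- r%:Z) ij.2 / q (- r%:Z) ij.2))
    (fun ij => [set v | Q ij.1 v] `&` [set v | Q ij.2 v]).
- by move=> k; exact: measurable_funM.
- by move=> ij; apply: measurableI; exact: measurable_rv_bool.
- move=> r w; rewrite big_allpairs_dep -expr2 sqr_sum.
  apply: eq_bigr => i _; apply: eq_bigr => j _.
  by rewrite mulrACA indicI.
split=> //; congr _%:E; apply: eq_bigr => r _; rewrite big_allpairs_dep /=.
rewrite -bernoulli_second_moment ?iota_uniq //; last exact: q_neq0.
rewrite [RHS]mulr_suml big_seq [RHS]big_seq; apply: eq_bigr => i' iJ.
rewrite [RHS]mulr_suml big_seq [RHS]big_seq; apply: eq_bigr => j jJ.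
by rewrite prob_sampled2 // mulrA.
Qed.

End Estimator.

(** * Assembly of the variance bound *)

Theorem theorem4p5 (R : realType) (V W : Type) (l : nat)
    (T : temporal_graph R V) (M : motif W l) (delta : R) (c : nat)
    (d : measure_display) (Omega : measurableType d) (P : probability Omega R)
    (s : {RV P >-> int}) (q : int -> nat -> R) (Q : nat -> {RV P >-> bool})
    (delta_gt0 : 0 < delta) (c_gt1 : (1 < c)%N)
    (cdelta_nat : c%:R * delta \is a Num.nat)
    (s_unif : uniform_shift c delta s)
    (p_correct : inclusion_prob_correct T M c delta s)
    (q_valid : valid_probs T M c delta q)
    (Q_indep : independent_sampling c delta s q Q) :
  ('V_P[Zest T M c delta s q Q] <=
     'E_P[fun w => sq_norm (Yhat T M c delta q (s w))]
     - 'E_P[fun w => sq_norm (Ycount T M c delta (s w))]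
     + ((c%:R - 1)^-1 * (instance_count T M delta)%:R ^+ 2)%:E)%E.
Proof.
have /natrP[n nE] := cdelta_nat.
have c0 : 0 < c%:R :> R by rewrite ltr0n ltnW.
have n0 : (0 < n)%N by rewrite -(ltr_nat R) -nE mulr_gt0.
have cd0 : 0 < c%:R * delta by exact: mulr_gt0.
have [N NP] := choice (contained_bound (l := l) T cd0).
have [Z1 EZ] := expectation_Zest s_unif n0 nE NP q_valid Q_indep.
have [Z2 EZ2] := expectation_sqr_Zest s_unif n0 nE NP q_valid Q_indep.
rewrite /variance covarianceE // EZ EZ2.
rewrite (mean_total_count delta_gt0 c_gt1 s_unif n0 nE NP p_correct).
rewrite (expectation_sq_norm_Yhat s_unif n0 nE NP q_valid).
rewrite (expectation_sq_norm_Ycount M s_unif n0 nE NP).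
rewrite -!EFinM -!EFinB -EFinD lee_fin.
have le := mean_sqr_total_count delta_gt0 c_gt1 s_unif n0 nE NP p_correct.
under eq_bigr do rewrite mulrBl mulrDl.
rewrite sumrB big_split /=.
(* In this splitting of [c / (c - 1)], the summand 1 is cancelled by the squared mean of the
   estimator. *)
have cE : (1 - c%:R^-1)^-1 = 1 + (c%:R - 1)^-1 :> R.
  have c1 : c%:R - 1 != 0 :> R by rewrite subr_eq0 pnatr_eq1 gtn_eqF.
  by field; rewrite c1 gt_eqF.
move: le; rewrite cE mulrDl mul1r expr2; lra.
Qed.
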